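(* Let $\mathbb{F}$ be $\mathbb{R}$ or $\mathbb{C}$, let $\mathbb{H}$ be a $d$-dimensional Hilbert space over $\mathbb{F}$, let $n>d$, and let $\{\varphi_j\}_{j=1}^{n}$ be an equiangular tight frame (ETF) for $\mathbb{H}$. Let $s=\left[\frac{d(n-1)}{n-d}\right]^{1/2}$. Then for $\mathcal{K}\subseteq\{1,\dots,n\}$, the subset $\{\varphi_j\}_{j\in\mathcal{K}}$ is a regular simplex if and only if it consists of $s+1$ linearly dependent vectors (i.e. $\#\mathcal{K}=s+1$ and $\{\varphi_j\}_{j\in\mathcal{K}}$ is linearly dependent). As a corollary, letting $\mu$ be the coherence of $\{\varphi_j\}_{j=1}^n$, the equality $\operatorname{spark}\{\varphi_j\}_{j=1}^{n}=\frac{1}{\mu}+1$ holds if and only if $\{\varphi_j\}_{j=1}^n$ contains a regular simplex.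
   Context: A finite sequence $\{\varphi_j\}_{j=1}^n$ of nonzero vectors in a Hilbert space $\mathbb{H}$ is equal norm if $\|\varphi_j\|$ is constant over $j$; an equal norm sequence is equiangular if $|\langle\varphi_j,\varphi_{j'}\rangle|$ is constant over all $j\neq j'$. It is a tight frame for $\mathbb{H}$ if there is $a>0$ such that $\sum_{j=1}^n\langle\varphi_j,y\rangle\varphi_j=ay$ for all $y\in\mathbb{H}$ (inner products are conjugate-linear in the first argument). An ETF for $\mathbb{H}$ is an equal norm equiangular sequence that is a tight frame for $\mathbb{H}$. For a positive integer $s$, a regular $s$-simplex is a sequence of $s+1$ vectors that is an ETF for its span, where this span has dimension $s$. A regular simplex is a regular $s$-simplex for some positive integer $s$. An ETF contains a regular simplex if some subset $\{\varphi_j\}_{j\in\mathcal{K}}$ of its vectors (indexed by $\mathcal{K}\subseteq\{1,\dots,n\}$) is a regular simplex. The coherence of equal norm nonzero vectors is $\mu=\max_{j\neq j'}\frac{|\langle\varphi_j,\varphi_{j'}\rangle|}{\|\varphi_j\|\|\varphi_{j'}\|}$. The spark of $\{\varphi_j\}_{j=1}^n$ is the smallest number of these vectors (as indexed vectors) that are linearly dependent. *)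

(* Defs.v *)
From HB Require Import structures.
From mathcomp Require Import all_boot all_order all_algebra.
From mathcomp Require Import sesquilinear.
From mathcomp Require Import reals complex.

Set Implicit Arguments.
Unset Strict Implicit.
Unset Printing Implicit Defensive.

Import Order.TTheory GRing.Theory Num.Theory.

Local Open Scope ring_scope.

Inductive scalar_kind := RealScalars | ComplexScalars.

Definition scalar_field (R : realType) (k : scalar_kind) : numFieldType :=
  match k with
  | RealScalars => R : numFieldType
  | ComplexScalars => R[i] : numFieldType
  end.

Definition sconj (R : realType) (k : scalar_kind) : scalar_field R k -> scalar_field R k :=
  match k with
  | RealScalars => fun x => x
  | ComplexScalars => fun z : R[i] => Num.conj z
  end.
Arguments sconj R k : clear implicits.

Definition sRe (R : realType) (k : scalar_kind) : scalar_field R k -> R :=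
  match k with
  | RealScalars => fun x => x
  | ComplexScalars => fun z : R[i] => complex.Re z
  end.

(* On [R[i]] the library norm [`|z|] is itself an element of [R[i]], with zero
   imaginary part. *)
Definition modulus (R : realType) (k : scalar_kind) (z : scalar_field R k) : R :=
  sRe `|z|.

(* A finite-dimensional Hilbert space is a [vectType] with a positive definite
   Hermitian form [form : {dot V for sconj R k}]; completeness is automatic.
   Families are indexed by a finite type [I], and a set [K] of indices selects
   the subfamily [(phi j)_(j in K)]. *)
Section Frames.

Variables (R : realType) (k : scalar_kind) (V : vectType (scalar_field R k)).
Variable form : {dot V for sconj R k}.

(* [form] is linear in its first argument, whereas [inner] is conjugate-linear
   in its first argument. *)
Definition inner (x y : V) : scalar_field R k := form y x.

Definition hnorm (x : V) : R := Num.sqrt (sRe (inner x x)).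

Variables (I : finType) (phi : I -> V).

Definition equal_norm (K : {set I}) : Prop :=
  exists r : R, forall j, j \in K -> hnorm (phi j) = r.

Definition equiangular (K : {set I}) : Prop :=
  exists c : R, forall j j', j \in K -> j' \in K -> j != j' ->
    modulus (inner (phi j) (phi j')) = c.

(* Over [R[i]], [0 < a] entails that [a] is real. *)
Definition tight_frame (K : {set I}) (U : {vspace V}) : Prop :=
  (forall j, j \in K -> phi j \in U) /\
  exists2 a : scalar_field R k, 0 < a &
    forall y, y \in U -> \sum_(j in K) inner (phi j) y *: phi j = a *: y.

Definition ETF (K : {set I}) (U : {vspace V}) : Prop :=
  [/\ forall j, j \in K -> phi j != 0,
      equal_norm K,
      equiangular K &
      tight_frame K U].

(* Listing the vectors as a sequence keeps repetitions, so that repeated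
   vectors are linearly dependent. *)
Definition subfamily (K : {set I}) : seq V := [seq phi j | j in K].

Definition lin_dependent (K : {set I}) : bool := ~~ free (subfamily K).

Definition regular_s_simplex (s : nat) (K : {set I}) : Prop :=
  [/\ #|K| = s.+1,
      \dim <<subfamily K>>%VS = s &
      ETF K <<subfamily K>>%VS].

Definition regular_simplex (K : {set I}) : Prop :=
  exists2 s : nat, (0 < s)%N & regular_s_simplex s K.

Definition contains_regular_simplex : Prop :=
  exists K : {set I}, regular_simplex K.

Definition coherence : R :=
  \big[Num.max/0]_(p : I * I | p.1 != p.2)
    (modulus (inner (phi p.1) (phi p.2)) /
       (hnorm (phi p.1) * hnorm (phi p.2))).

(* The default value [#|I|.+1] is only reached by linearly independent
   families. *)
Definition spark : nat :=
  \big[minn/#|I|.+1]_(K : {set I} | lin_dependent K) #|K|.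

End Frames.

(* Main.v *)
Require Import Defs.
From HB Require Import structures.
From mathcomp Require Import all_boot all_order all_algebra.
From mathcomp Require Import sesquilinear.
From mathcomp Require Import reals complex.
From mathcomp Require Import boolp.
From mathcomp Require Import ring lra.

Set Implicit Arguments.
Unset Strict Implicit.
Unset Printing Implicit Defensive.

Import Order.TTheory GRing.Theory Num.Theory.

Local Open Scope ring_scope.

(** Write r for the common squared norm of the vectors and c for the common
modulus of the inner products of distinct vectors.

Two identities hold for every equiangular tight frame of m such vectors with
frame constant a, in a space U of dimension u.  The trace of the frame operator
gives m r = a u, and pairing the frame identity at one vector with that same
vector gives r^2 + (m - 1) c^2 = a r.  Eliminating a leaves
u (r^2 + (m - 1) c^2) = m r^2 ([equiangular_gram_tight]).  For the whole frame
this is the equality case of the Welch bound, r / c = s; for s' + 1 vectors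
that span s' dimensions it says r / c = s'.  Hence a regular simplex inside the
frame has s + 1 vectors, and these are dependent because they span a space of
smaller dimension.

For the converse, let z be a linear relation among the vectors indexed by K.
The row of the Gram matrix at an index i where |z i| is maximal reads
r = - sum_(j != i) <phi i, phi j> (z j / z i), with #|K| - 1 terms of modulus at
most c.  So r <= (#|K| - 1) c, that is #|K| >= s + 1
([lin_dependent_bound], a Gershgorin argument).  If #|K| = s + 1 the triangle
inequality is an equality, so every term equals c.  Thus all the |z j| agree,
every row is maximal, and <phi i, phi j> z j = - c z i for all i != j
([relation_rigid]).  Inserting this in the frame operator and using the
relation once more shows that it acts on the span as r + c
([rigid_tight_frame]).  The vectors form a tight frame for their span, and the
identity above forces its dimension to be s.

The corollary follows: the coherence is c / r = 1 / s, every dependent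
subfamily has at least s + 1 vectors, and those with exactly s + 1 are the
regular simplices. *)

(** * Scalars *)

(** Real quantities such as r and c enter identities between scalars of either
kind; this ring embedding carries such identities back to the reals. *)
Definition embed (R : realType) (k : scalar_kind) : R -> scalar_field R k :=
  match k with
  | RealScalars => fun x => x
  | ComplexScalars => fun x => real_complex R x
  end.

Lemma embed_zmod_morphism (R : realType) (k : scalar_kind) :
  zmod_morphism (@embed R k).
Proof. by case: k => // x y; exact: (rmorphB (real_complex R)). Qed.

Lemma embed_monoid_morphism (R : realType) (k : scalar_kind) :
  monoid_morphism (@embed R k).
Proof.
by case: k; split=> // x y; exact: (rmorphM (real_complex R)).
Qed.

HB.instance Definition _ (R : realType) (k : scalar_kind) :=
  GRing.isZmodMorphism.Build R (scalar_field R k) (@embed R k)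
    (@embed_zmod_morphism R k).
HB.instance Definition _ (R : realType) (k : scalar_kind) :=
  GRing.isMonoidMorphism.Build R (scalar_field R k) (@embed R k)
    (@embed_monoid_morphism R k).

Section Scalars.

Variables (R : realType) (k : scalar_kind).
Local Notation F := (scalar_field R k).
Local Notation "x %:F" := (@embed R k x) (format "x %:F").

Lemma embedK (x : R) : sRe x%:F = x.
Proof. by rewrite /embed /sRe; case: k. Qed.

Lemma embed_inj : injective (@embed R k).
Proof. exact: can_inj embedK. Qed.

Lemma ler_embed (x y : R) : (x%:F <= y%:F) = (x <= y).
Proof. by rewrite /embed; case: k => //; exact: lecR. Qed.

Lemma ltr_embed (x y : R) : (x%:F < y%:F) = (x < y).
Proof. by rewrite /embed; case: k => //; exact: ltcR. Qed.

Lemma norm_modulus (z : F) : `|z| = (modulus z)%:F.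
Proof. by move: z; rewrite /modulus /sRe /embed; case: k. Qed.

Lemma gt0_embed (z : F) : 0 < z -> z = (sRe z)%:F.
Proof.
move: z; rewrite /sRe /embed; case: k => // z z_gt0.
by rewrite -[LHS](gtr0_norm z_gt0) -[in RHS](gtr0_norm z_gt0).
Qed.

Lemma mul_sconj (z : F) : z * sconj R k z = `|z| ^+ 2.
Proof.
move: z; rewrite /sconj; case: k => z /=; last by rewrite -normCK.
by rewrite -expr2 real_normK ?num_real.
Qed.

(** The equality case of the triangle inequality: the real part of each [w i] is
at most [g i], so no term can fall short of its bound. *)
Lemma eq_sum_upper (I : finType) (P : pred I) (w g : I -> F) :
    (forall i, P i -> `|w i| <= g i) ->
    \sum_(i | P i) w i = \sum_(i | P i) g i ->
  forall i, P i -> w i = g i.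
Proof.
move: w g; case: k => /= w g le_wg eq_sum i Pi; last exact: normC_sum_upper Pi.
apply/eqP; rewrite eq_sym -subr_eq0; apply/eqP; move: i Pi.
apply: psumr_eq0P => [i Pi|]; last by rewrite sumrB eq_sum subrr.
by rewrite subr_ge0 (le_trans (ler_norm _)) ?le_wg.
Qed.

End Scalars.

(** * Inner products and Gram matrices *)

Section Frames.

Variables (R : realType) (k : scalar_kind) (V : vectType (scalar_field R k)).
Variable form : {dot V for sconj R k}.
Local Notation F := (scalar_field R k).
Local Notation "x %:F" := (@embed R k x) (format "x %:F").
Local Notation "''[' x , y ]" := (inner form x y).

Lemma innerZr (a : F) (x y : V) : '[x, a *: y] = a * '[x, y].
Proof. exact: (@linearl_subproof _ _ _ _ _ _ form x a y). Qed.

Lemma inner_sumr (I : finType) (P : pred I) (x : V) (y : I -> V) :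
  '[x, \sum_(i | P i) y i] = \sum_(i | P i) '[x, y i].
Proof.
have innerB u v : '[x, u - v] = '[x, u] - '[x, v].
  exact: (@zmod_morphisml_subproof _ _ _ _ _ _ form x).
have inner0 : '[x, 0] = 0 by rewrite -(subrr 0) innerB subrr.
have innerN u : '[x, - u] = - '[x, u] by rewrite -sub0r innerB inner0 sub0r.
apply: (big_morph _ _ inner0) => u v.
by rewrite -[v in LHS]opprK innerB innerN opprK.
Qed.

Lemma inner_sconj (x y : V) : '[x, y] = sconj R k '[y, x].
Proof. by rewrite /inner (@hermitian_subproof _ _ _ _ form) expr0 mul1r. Qed.

Lemma inner_mul_swap (x y : V) : '[x, y] * '[y, x] = `|'[x, y]| ^+ 2.
Proof. by rewrite -mul_sconj -inner_sconj. Qed.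

Lemma inner_gt0 (x : V) : x != 0 -> 0 < '[x, x].
Proof. exact: (@neq0_dnorm_gt0 _ _ _ form x). Qed.

Lemma inner_hnorm (x : V) : x != 0 -> '[x, x] = (hnorm form x ^+ 2)%:F.
Proof.
move=> /inner_gt0 xx_gt0; have eq_xx := gt0_embed xx_gt0.
rewrite sqr_sqrtr -?eq_xx // ltW // -(ltr_embed k) -eq_xx.
by rewrite (rmorph0 (@embed R k)).
Qed.

Variables (I : finType) (phi : I -> V).
Implicit Types (K : {set I}) (z : I -> F).

(** Recording r and c as constants, rather than quantifying them existentially
as [equal_norm] and [equiangular] do, lets a family and its subfamilies share
them. *)
Definition equiangular_gram K (r c : R) : Prop :=
  (forall i, i \in K -> '[phi i, phi i] = r%:F) /\
  (forall i j, i \in K -> j \in K -> i != j -> `|'[phi i, phi j]| = c%:F).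

Lemma equiangular_gram_sub K (L : {set I}) r c :
  K \subset L -> equiangular_gram L r c -> equiangular_gram K r c.
Proof.
move=> /subsetP KL [gram_diag gram_off]; split=> [i /KL|i j /KL Li /KL].
  exact: gram_diag.
exact: gram_off.
Qed.

Lemma ETF_equiangular_gram K (U : {vspace V}) :
    (exists i, i \in K) -> ETF form phi K U ->
  exists r c, 0 < r /\ equiangular_gram K r c.
Proof.
move=> [i0 Ki0] [phi_neq0 [r norm_r] [c mod_c] _].
exists (r ^+ 2), c; split; last split=> [i Ki|i j Ki Kj ij].
- rewrite -(ltr_embed k) -(norm_r i0) // -inner_hnorm ?phi_neq0 //.
  by rewrite (rmorph0 (@embed R k)) inner_gt0 ?phi_neq0.
- by rewrite -(norm_r i) // inner_hnorm ?phi_neq0.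
- by rewrite norm_modulus mod_c.
Qed.

Lemma equiangular_gram_ETF K r c (U : {vspace V}) :
    0 < r -> equiangular_gram K r c -> tight_frame form phi K U ->
  ETF form phi K U.
Proof.
move=> r_gt0 [gram_diag gram_off] tightK.
have phi_neq0 i : i \in K -> phi i != 0.
  move=> Ki; apply: contraTneq r_gt0 => phi0.
  have /(congr1 (@sRe R k)) := gram_diag i Ki.
  rewrite embedK phi0 -[X in '[_, X]](scale0r (0 : V)) innerZr mul0r.
  by rewrite -(rmorph0 (@embed R k)) embedK => <-; rewrite ltxx.
split=> //.
- by exists (Num.sqrt r) => i Ki; rewrite /hnorm gram_diag // embedK.
- by exists c => i j Ki Kj ij; rewrite /modulus gram_off // embedK.
Qed.

(** * The trace and row identities of an equiangular tight frame *)

(** Both sides are the trace of the frame operator on [U]: in coordinates with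
respect to a basis of [U], a trace of a product may be taken in either order. *)
Lemma tight_trace K (U : {vspace V}) (a : F) :
    (forall j, j \in K -> phi j \in U) ->
    (forall y, y \in U -> \sum_(j in K) '[phi j, y] *: phi j = a *: y) ->
  \sum_(j in K) '[phi j, phi j] = a * (\dim U)%:R.
Proof.
move=> phiU tightK; set b := vbasis U.
have bU (i : 'I_(\dim U)) : b`_i \in U by rewrite vbasis_mem ?mem_nth ?size_tuple.
have -> : a * (\dim U)%:R = \sum_(i < \dim U) coord b i (a *: b`_i).
  rewrite (eq_bigr (fun=> a)) => [|i _].
    by rewrite sumr_const card_ord mulr_natr.
  by rewrite linearZ /= coord_free ?eqxx ?mulr1 // (basis_free (vbasisP U)).
under [RHS]eq_bigr => i _ do rewrite -tightK // linear_sum /=.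
rewrite exchange_big /=; apply: eq_bigr => j Kj.
rewrite {2}(coord_vbasis (phiU j Kj)) inner_sumr; apply: eq_bigr => i _.
by rewrite innerZr linearZ /= mulrC.
Qed.

(** The frame constant a is eliminated between m r = a u, which is
[tight_trace], and r^2 + (m - 1) c^2 = a r, which pairs the frame identity at
[phi i0] with [phi i0].  For the whole frame this computes r / c; for a
candidate simplex it ties the number of vectors to the dimension of the span. *)
Lemma equiangular_gram_tight K r c (U : {vspace V}) i0 :
    i0 \in K -> equiangular_gram K r c -> tight_frame form phi K U ->
  (\dim U)%:R * (r ^+ 2 + #|K|.-1%:R * c ^+ 2) = #|K|%:R * r ^+ 2.
Proof.
move=> Ki0 [gram_diag gram_off] [phiU [a _ tightK]]; apply: (@embed_inj R k).
have trK : #|K|%:R * r%:F = a * (\dim U)%:R.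
  rewrite -(tight_trace phiU tightK) (eq_bigr _ gram_diag) sumr_const.
  by rewrite mulr_natl.
have rowK : r%:F ^+ 2 + #|K|.-1%:R * c%:F ^+ 2 = a * r%:F.
  rewrite -(gram_diag i0 Ki0) -innerZr -tightK ?phiU // inner_sumr.
  rewrite (big_setD1 i0) //= innerZr -expr2; congr (_ + _).
  rewrite (eq_bigr (fun=> c%:F ^+ 2)) => [|j]; last first.
    rewrite 2!inE => /andP[ji0 Kj]; rewrite innerZr inner_mul_swap.
    by rewrite gram_off.
  by rewrite sumr_const mulr_natl (cardsD1 i0 K) Ki0.
rewrite !(rmorphXn, rmorphD, rmorphM, rmorph_nat) /= rowK.
by rewrite expr2 [RHS]mulrA trK; ring.
Qed.

(** * Linear relations and the Gershgorin bound *)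

Lemma lin_dependentP K :
  lin_dependent phi K ->
  exists2 z, \sum_(j in K) z j *: phi j = 0 & exists2 i, i \in K & z i != 0.
Proof.
have sizeX : size (subfamily phi K) == #|K| by rewrite size_image.
rewrite /lin_dependent => /negP nfree.
have : ~ forall b : 'I_#|K| -> F,
    \sum_(i < #|K|) b i *: (Tuple sizeX)`_i = 0 -> forall i, b i = 0.
  by move/freeP.
move=> /existsNP[b] /not_implyP[sum_b] /existsNP[i /eqP b_i].
have Ki := enum_valP i; pose rank := enum_rank_in Ki.
exists (b \o rank).
  rewrite big_enum_val -[RHS]sum_b.
  by apply: eq_bigr => j _; rewrite /= /rank enum_valK_in nth_image.
by exists (enum_val i) => //=; rewrite /rank enum_valK_in.
Qed.

Lemma dim_lt_lin_dependent K :
  (\dim <<subfamily phi K>> < #|K|)%N -> lin_dependent phi K.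
Proof.
by move=> ltK; rewrite /lin_dependent /free size_image neq_ltn ltK.
Qed.

(** Maximality is taken over [modulus], which is real valued, since the order on
the complex scalars is only partial. *)
Lemma exists_max_coef K z :
    (exists2 i, i \in K & z i != 0) ->
  exists i, [/\ i \in K, z i != 0 & forall j, j \in K -> `|z j| <= `|z i|].
Proof.
move=> [i0 Ki0 z_i0].
have [i Ki max_i] := arg_maxP (fun j => modulus (z j)) Ki0.
have le_i j : j \in K -> `|z j| <= `|z i|.
  by move=> Kj; rewrite !norm_modulus ler_embed; exact: max_i.
exists i; split=> //; rewrite -normr_gt0.
by apply: lt_le_trans (le_i i0 Ki0); rewrite normr_gt0.
Qed.

(** The [i]-th coordinate of the equation stating that the Gram matrix kills
[z], divided by [z i] so that the right-hand side no longer depends on [z]. *)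
Lemma relation_row K r c z i :
    equiangular_gram K r c -> \sum_(j in K) z j *: phi j = 0 ->
    i \in K -> z i != 0 ->
  \sum_(j in K :\ i) - ('[phi i, phi j] * (z j / z i)) = r%:F.
Proof.
move=> [gram_diag _] rel_z Ki z_i.
have := congr1 (inner form (phi i)) rel_z.
rewrite -[X in _ = '[_, X]](scale0r (0 : V)) innerZr mul0r inner_sumr.
rewrite (big_setD1 i) //= innerZr gram_diag // => /eqP.
rewrite addr_eq0 => /eqP rowE; apply: (mulfI z_i); rewrite rowE.
rewrite mulr_sumr -sumrN; apply: eq_bigr => j _; rewrite innerZr.
by rewrite mulrN mulrCA [z i * _]mulrC divfK // mulrC.
Qed.

Lemma card_setD1_pred K i : i \in K -> #|K :\ i| = #|K|.-1.
Proof. by move=> Ki; rewrite (cardsD1 i K) Ki. Qed.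

Lemma relation_term_le K r c z i :
    equiangular_gram K r c -> i \in K -> z i != 0 ->
    (forall j, j \in K -> `|z j| <= `|z i|) ->
  forall j, j \in K :\ i -> `|- ('[phi i, phi j] * (z j / z i))| <= c%:F.
Proof.
move=> [_ gram_off] Ki z_i max_i j; rewrite 2!inE eq_sym => /andP[ij Kj].
rewrite normrN normrM gram_off // ler_piMr //.
  by rewrite -(gram_off i j) ?normr_ge0.
by rewrite normf_div ler_pdivrMr ?normr_gt0 // mul1r max_i.
Qed.

(** Gershgorin: in the row of a coefficient of maximal modulus, [#|K|.-1] terms
of modulus at most [c] add up to [r]. *)
Lemma lin_dependent_bound K r c :
    0 < r -> equiangular_gram K r c -> lin_dependent phi K ->
  r <= #|K|.-1%:R * c.
Proof.
move=> r_gt0 gramK /lin_dependentP[z rel_z /exists_max_coef[i [Ki z_i max_i]]].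
rewrite -(ler_embed k) -(ger0_norm (_ : 0 <= r%:F)); last first.
  by rewrite -(rmorph0 (@embed R k)) ler_embed ltW.
rewrite -(relation_row gramK rel_z Ki z_i) (le_trans (ler_norm_sum _ _ _)) //.
apply: le_trans (ler_sum _ (relation_term_le gramK Ki z_i max_i)) _.
by rewrite sumr_const card_setD1_pred // rmorphM rmorph_nat /= mulr_natl.
Qed.

(** When the Gershgorin bound is attained, the row of a maximal coefficient is an
equality case of the triangle inequality, so all its terms equal [c].  Taking
moduli, every coefficient is then maximal, and the argument applies to every
row. *)
Lemma relation_rigid K r c :
    0 < r -> equiangular_gram K r c -> lin_dependent phi K ->
    r = #|K|.-1%:R * c ->
  exists z, [/\ \sum_(j in K) z j *: phi j = 0,
    forall j, j \in K -> z j != 0 &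
    forall i j, i \in K -> j \in K -> i != j ->
      '[phi i, phi j] * z j = - (c%:F * z i)].
Proof.
move=> r_gt0 gramK depK eq_rc.
have c_neq0 : c%:F != 0.
  rewrite -(rmorph0 (@embed R k)) (inj_eq (@embed_inj R k)).
  by apply: contraTneq r_gt0 => c0; rewrite eq_rc c0 mulr0 ltxx.
have [z rel_z /exists_max_coef[i0 [Ki0 z_i0 max_i0]]] := lin_dependentP depK.
have row_eq i : i \in K -> z i != 0 ->
    (forall j, j \in K -> `|z j| <= `|z i|) ->
  forall j, j \in K -> i != j -> '[phi i, phi j] * z j = - (c%:F * z i).
  move=> Ki z_i max_i j Kj ij.
  have sum_eq : \sum_(j in K :\ i) - ('[phi i, phi j] * (z j / z i)) =
      \sum_(j in K :\ i) c%:F.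
    rewrite (relation_row gramK rel_z) // sumr_const card_setD1_pred //.
    by rewrite eq_rc rmorphM rmorph_nat /= mulr_natl.
  have := eq_sum_upper (relation_term_le gramK Ki z_i max_i) sum_eq.
  move=> /(_ j); rewrite 2!inE eq_sym ij Kj => /(_ isT) <-.
  by rewrite mulNr opprK mulrA divfK.
have norm_z j : j \in K -> `|z j| = `|z i0|.
  move=> Kj; have [->//|i0j] := eqVneq i0 j.
  have := congr1 Num.norm (row_eq i0 Ki0 z_i0 max_i0 j Kj i0j).
  have [_ gram_off] := gramK.
  rewrite normrN !normrM -(gram_off i0 j) // normr_id; apply: mulfI.
  by rewrite gram_off.
have z_neq0 j : j \in K -> z j != 0.
  by move=> Kj; rewrite -normr_gt0 norm_z // normr_gt0.
exists z; split=> // i j Ki Kj ij; apply: row_eq => //; first exact: z_neq0.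
by move=> l Kl; rewrite !norm_z.
Qed.

(** * Regular simplices *)

(** Applied to [z i *: phi i], the frame operator gives
r z_i phi_i - c sum_(j != i) z_j phi_j by rigidity, and the relation turns the
last sum into - z_i phi_i.  So the frame constant is r + c. *)
Lemma rigid_tight_frame K r c :
    0 < r -> equiangular_gram K r c -> lin_dependent phi K ->
    r = #|K|.-1%:R * c ->
  tight_frame form phi K <<subfamily phi K>>%VS.
Proof.
move=> r_gt0 gramK depK eq_rc.
have [z [rel_z z_neq0 off_z]] := relation_rigid r_gt0 gramK depK eq_rc.
split=> [j Kj|]; first by rewrite memv_span // image_f.
have frame_phi i : i \in K ->
    \sum_(j in K) '[phi j, phi i] *: phi j = (r + c)%:F *: phi i.
  (* Scaling by [z i] makes rigidity applicable to [phi i] without any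
     conjugation. *)
  move=> Ki; have [gram_diag _] := gramK; apply: (scalerI (z_neq0 i Ki)).
  have rel_i : \sum_(j in K :\ i) z j *: phi j = - (z i *: phi i).
    by apply/eqP; rewrite -addr_eq0 addrC -big_setD1 // rel_z.
  rewrite (big_setD1 i) //= gram_diag // scalerDr scaler_sumr.
  rewrite (eq_bigr (fun j => (- c%:F) *: (z j *: phi j))) => [|j]; last first.
    rewrite 2!inE => /andP[ji Kj]; rewrite !scalerA mulrC off_z //.
    by rewrite mulNr.
  rewrite -scaler_sumr rel_i scalerN scaleNr opprK !scalerA -scalerDl.
  by rewrite rmorphD /=; congr (_ *: _); ring.
exists (r + c)%:F.
  rewrite -(rmorph0 (@embed R k)) ltr_embed ltr_wpDr //.
  have : 0 < #|K|.-1%:R * c by rewrite -eq_rc.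
  case: #|K|.-1 => [|m]; first by rewrite mul0r ltxx.
  by rewrite pmulr_rgt0 ?ltr0Sn // => /ltW.
have sizeX : size (subfamily phi K) == #|K| by rewrite size_image.
move=> y; rewrite -[subfamily phi K]/(tval (Tuple sizeX)) => /coord_span y_def.
set b := fun i => coord (Tuple sizeX) i y.
have {}y_def : y = \sum_(i < #|K|) b i *: phi (enum_val i).
  by rewrite {1}y_def; apply: eq_bigr => i _; rewrite nth_image.
rewrite y_def scaler_sumr.
rewrite (eq_bigr (fun j => \sum_(i < #|K|)
   b i *: ('[phi j, phi (enum_val i)] *: phi j))); last first.
  move=> j _; rewrite inner_sumr scaler_suml; apply: eq_bigr => i _.
  by rewrite innerZr scalerA.
rewrite exchange_big /=; apply: eq_bigr => i _.
by rewrite -scaler_sumr frame_phi ?enum_valP // !scalerA mulrC.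
Qed.

(** [equiangular_gram_tight] serves in both directions.  With m = #|K| - 1, it
yields m^2 c^2 = r^2 when the span has dimension m, and it yields dimension m
for the span when r = m c. *)
Lemma regular_simplexP K r c :
    0 < r -> 0 < c -> equiangular_gram K r c ->
  regular_simplex form phi K <-> r = #|K|.-1%:R * c /\ lin_dependent phi K.
Proof.
move=> r_gt0 c_gt0 gramK; split=> [[s s_gt0 [cardK dimK [_ _ _ tightK]]]|].
  split; last by rewrite dim_lt_lin_dependent // cardK dimK.
  have [i Ki] : exists i, i \in K by apply/card_gt0P; rewrite cardK.
  have := equiangular_gram_tight Ki gramK tightK.
  rewrite cardK dimK /= -natr1 => eq_s.
  apply/eqP; rewrite -(@eqrXn2 _ 2) // ?(ltW r_gt0) ?mulr_ge0 ?ler0n ?ltW //.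
  by rewrite exprMn; apply/eqP; lra.
move=> [eq_rc depK].
have tightK := rigid_tight_frame r_gt0 gramK depK eq_rc.
have K_gt1 : (0 < #|K|.-1)%N.
  by rewrite lt0n; apply: contraTneq r_gt0 => K1; rewrite eq_rc K1 mul0r ltxx.
have cardK : #|K| = #|K|.-1.+1 by case: #|K| K_gt1.
exists #|K|.-1 => //; split=> //; last exact: equiangular_gram_ETF r_gt0 gramK tightK.
have [i Ki] : exists i, i \in K by apply/card_gt0P; rewrite cardK.
have := equiangular_gram_tight Ki gramK tightK.
set m := #|K|.-1 in eq_rc K_gt1 cardK *; rewrite cardK => eq_dim.
apply/eqP; rewrite -(eqr_nat R) -subr_eq0.
have : (m%:R + 1) * m%:R * c ^+ 2 * ((\dim <<subfamily phi K>>)%:R - m%:R) = 0.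
  by move: eq_dim; rewrite eq_rc -natr1; lra.
move=> /eqP; rewrite !mulf_eq0 natr1 pnatr_eq0 (gt_eqF c_gt0) /=.
by rewrite pnatr_eq0 eqn0Ngt K_gt1.
Qed.

(** * Coherence and spark *)

(** The distinct pair [i], [j] is there because the maximum over no pairs would
be 0. *)
Lemma equiangular_gram_coherence r c (i j : I) :
    i != j -> 0 < r -> 0 <= c -> equiangular_gram [set: I] r c ->
  coherence form phi = c / r.
Proof.
move=> ij r_gt0 c_ge0 [gram_diag gram_off].
have termE (p : I * I) : p.1 != p.2 ->
    modulus '[phi p.1, phi p.2] / (hnorm form (phi p.1) * hnorm form (phi p.2))
  = c / r.
  move=> p12; rewrite /modulus gram_off ?inE // embedK /hnorm.
  by rewrite !gram_diag ?inE // embedK -expr2 sqr_sqrtr // ltW.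
rewrite /coherence (eq_bigr _ termE); apply/le_anti/andP; split.
  by apply/bigmax_leP; split=> //; rewrite divr_ge0 // ltW.
exact: (@le_bigmax_cond _ R _ 0 (i, j) (fun p => p.1 != p.2) (fun=> c / r)) ij.
Qed.

Lemma spark_le K : lin_dependent phi K -> (spark phi <= #|K|)%N.
Proof.
move=> depK; rewrite /spark -minEnat -leEnat.
exact: (@bigmin_le_cond _ nat _ _ K (lin_dependent phi) (fun L => #|L|) depK).
Qed.

(** Some dependent subfamily must exist, for otherwise the minimum takes its
default value [#|I|.+1]. *)
Lemma spark_attained K :
  lin_dependent phi K -> exists2 L, lin_dependent phi L & #|L| = spark phi.
Proof.
move=> depK; have : (spark phi < #|I|.+1)%N.
  by rewrite ltnS (leq_trans (spark_le depK)) // max_card.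
rewrite /spark; elim/big_ind: _ => [|x y Px Py|L depL _]; first by rewrite ltnn.
  by rewrite /minn; case: ifP => _; [exact: Px | exact: Py].
by exists L.
Qed.

End Frames.

Theorem theorem3p1 (R : realType) (k : scalar_kind) (V : vectType (scalar_field R k))
    (form : {dot V for sconj R k}) (d n : nat) (phi : 'I_n -> V) :
  \dim {:V} = d -> (d < n)%N -> ETF form phi [set: 'I_n] {:V}%VS ->
  let s : R := Num.sqrt (d%:R * (n%:R - 1) / (n%:R - d%:R)) in
  (forall K : {set 'I_n},
     regular_simplex form phi K <->
     #|K|%:R = s + 1 /\ lin_dependent phi K) /\
  ((spark phi)%:R = (coherence form phi)^-1 + 1 <->
   contains_regular_simplex form phi).
Proof.
move=> dimV lt_dn etf s; pose i0 : 'I_n := Ordinal (leq_ltn_trans (leq0n d) lt_dn).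
have [r [c [r_gt0 gram0]]] :
    exists r c, 0 < r /\ equiangular_gram form phi [set: 'I_n] r c.
  by apply: ETF_equiangular_gram etf; exists i0; rewrite inE.
have d_gt0 : (0 < d)%N.
  rewrite -dimV lt0n dimv_eq0; apply/eqP => V0; case: etf => phi_neq0 _ _ _.
  by have := phi_neq0 i0 (in_setT _); have := memvf (phi i0); rewrite V0 memv0 => ->.
have n_gt1 : (1 < n)%N by exact: leq_ltn_trans d_gt0 lt_dn.
pose i1 : 'I_n := Ordinal n_gt1.
have i01 : i0 != i1 by [].
have c_ge0 : 0 <= c.
  have [_ /(_ i0 i1)] := gram0; rewrite !inE => /(_ isT isT i01) norm_c.
  by rewrite -(ler_embed k) (rmorph0 (@embed R k)) -norm_c.
have nd_gt0 : 0 < n%:R - d%:R :> R by rewrite subr_gt0 ltr_nat.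
have n1_gt0 : 0 < n%:R - 1 :> R by rewrite subr_gt0 ltr1n.
have dR_gt0 : 0 < d%:R :> R by rewrite ltr0n.
have [_ _ _ tightT] := etf.
(* The equality case of the Welch bound. *)
have welch : d%:R * (n%:R - 1) * c ^+ 2 = (n%:R - d%:R) * r ^+ 2.
  have := equiangular_gram_tight (in_setT i0) gram0 tightT.
  rewrite dimV cardsT card_ord -subn1 natrB ?(ltnW n_gt1) // => eq_n.
  by lra.
have c_gt0 : 0 < c.
  rewrite lt_neqAle c_ge0 andbT; apply: contraTneq r_gt0 => c0.
  move: welch; rewrite -c0 expr0n /= mulr0 => /esym/eqP.
  by rewrite mulf_eq0 (gt_eqF nd_gt0) expf_eq0 /= => /eqP ->; rewrite ltxx.
have s_def : s = r / c.
  rewrite /s -[RHS]ger0_norm ?divr_ge0 ?ltW // -sqrtr_sqr; congr Num.sqrt.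
  rewrite expr_div_n; apply/eqP; rewrite eqr_div ?expf_neq0 ?lt0r_neq0 //.
  by rewrite welch mulrC.
have coh : (coherence form phi)^-1 = s.
  by rewrite (equiangular_gram_coherence i01 r_gt0 c_ge0 gram0) s_def invf_div.
have gramK (K : {set 'I_n}) : equiangular_gram form phi K r c.
  exact: equiangular_gram_sub (subsetT K) gram0.
have r_def : r = s * c by rewrite s_def divfK // gt_eqF.
have cardE (K : {set 'I_n}) : #|K|%:R = s + 1 <-> r = #|K|.-1%:R * c.
  case: #|K| => [|m] /=.
    rewrite mul0r; split=> [s1|r0]; last by move: r_gt0; rewrite r0 ltxx.
    have s_ge0 : 0 <= s by exact: sqrtr_ge0.
    by lra.
  rewrite -natr1 r_def; split=> [/addIr -> //|/mulIf ->] //.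
  by rewrite gt_eqF.
have simplexE (K : {set 'I_n}) : regular_simplex form phi K <->
     #|K|%:R = s + 1 /\ lin_dependent phi K.
  rewrite (cardE K); exact: regular_simplexP.
split=> //; rewrite coh; split=> [spark_eq|[K /simplexE[cardK depK]]].
  have depT : lin_dependent phi [set: 'I_n].
    rewrite dim_lt_lin_dependent // cardsT card_ord (leq_ltn_trans _ lt_dn) //.
    by rewrite -dimV dimvS ?subvf.
  have [K depK cardK] := spark_attained depT.
  by exists K; apply/simplexE; rewrite cardK.
have [L depL cardL] := spark_attained depK.
apply/eqP; rewrite eq_le -[X in _ <= X]cardK ler_nat spark_le //= -cardL.
have := lin_dependent_bound r_gt0 (gramK L) depL.
case: #|L| => [|m]; first by rewrite mul0r leNgt r_gt0.
by rewrite r_def ler_pM2r // -natr1 lerD2r.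
Qed.
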